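(* For every integer $r\geq 2$ there exists $\epsilon_0>0$ such that for every $0<\epsilon\le\epsilon_0$ there exists $C$ such that if $p=p(n)\in[0,1]$ satisfies $p\geq \frac{C}{n}$, then asymptotically almost surely every $r$-coloring of the edges of $G(n,p)$ contains either a monochromatic tree of order at least $(1-\epsilon)n$ or a monochromatic tree with at least $(1-\epsilon)\frac{n}{r-1}$ leaves; in particular, asymptotically almost surely $\mathrm{tm}_r(G(n,p))\geq (1-\epsilon)\frac{n}{r-1}$.
   Context: $G(n,p)$ is the binomial random graph on $n$ vertices in which each pair is an edge independently with probability $p$. A sequence of events $A_n$ holds asymptotically almost surely if $\Pr[A_n]\to 1$ as $n\to\infty$. An $r$-coloring is an arbitrary assignment of one of $r$ colors to each edge. The order of a tree is its number of vertices; trees are subgraphs (not necessarily induced). For a graph $G$, $\mathrm{tm}_r(G)$ is the maximum integer $s$ such that in every $r$-coloring of the edges of $G$ there exists a monochromatic component (connected monochromatic subgraph) with at least $s$ vertices. *)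

(* Defs.v *)
From mathcomp Require Import all_boot all_order all_algebra.
From mathcomp Require Import all_classical all_reals all_analysis.

Set Implicit Arguments.
Unset Strict Implicit.
Unset Printing Implicit Defensive.

Import Order.TTheory GRing.Theory Num.Theory.
Import numFieldNormedType.Exports.

Local Open Scope classical_set_scope.
Local Open Scope ring_scope.

Definition vpair (T : finType) : Type := {e : {set T} | #|e| == 2%N}.

(* A finite simple graph with vertex set T is its set of edges. *)
Definition graph (T : finType) : Type := {set vpair T}.

Definition adj (T : finType) (F : graph T) : rel T :=
  fun x y => [exists e in F, val e == [set x; y]%SET].

(* Subgraphs are not necessarily induced and not necessarily spanning. *)
Record subgraph (T : finType) (G : graph T) := Subgraph {
  vertices : {set T};
  edges : graph T;
  edges_sub : edges \subset G;
  ends_sub : forall e, e \in edges -> val e \subset vertices }.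

Section Subgraph.
Variables (T : finType) (G : graph T).
Implicit Type H : subgraph G.

(* Edges of H have both ends in vertices H, so walks do not leave H. *)
Definition connected_sg H : Prop :=
  vertices H != finset.set0 /\
  {in vertices H &, forall x y, connect (adj (edges H)) x y}.

(* The closed walks x -- y -- x of length 2 are not graph cycles. *)
Definition acyclic_sg H : Prop :=
  forall s : seq T, (2 < size s)%N -> ~ ucycle (adj (edges H)) s.

Definition tree_sg H : Prop := connected_sg H /\ acyclic_sg H.

Definition order_sg H : nat := #|vertices H|.

Definition deg H (x : T) : nat := #|[set e in edges H | x \in val e]%SET|.

Definition num_leaves H : nat :=
  #|[set x in vertices H | deg H x == 1%N]%SET|.

End Subgraph.

(* A coloring of the edges of G is given by a function on all pairs, whose
   values outside G play no role. *)
Definition coloring (r : nat) (T : finType) : Type := {ffun vpair T -> 'I_r}.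

Definition monochromatic (r : nat) (T : finType) (G : graph T)
    (c : coloring r T) (H : subgraph G) : Prop :=
  exists i : 'I_r, forall e, e \in edges H -> c e = i.

Definition forces_component (r : nat) (T : finType) (G : graph T) (s : nat) :
    Prop :=
  forall c : coloring r T, exists H : subgraph G,
    [/\ connected_sg H, monochromatic c H & (s <= order_sg H)%N].

(* No subgraph has more than #|T| vertices, so the bound on s is harmless;
   see forces_componentP. *)
Definition tm (r : nat) (T : finType) (G : graph T) : nat :=
  (\max_(s < #|T|.+1 | `[< forces_component r G s >]) s)%N.

Lemma forces_componentP (r : nat) (T : finType) (G : graph T) (s : nat) :
  (0 < r)%N -> (0 < #|T|)%N -> forces_component r G s <-> (s <= tm r G)%N.
Proof.
move=> r0 T0; have /card_gt0P[x _] := T0.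
split=> [Fs | le_s c].
  have [H [_ _ leH]] := Fs [ffun=> Ordinal r0].
  have ltsT : (s < #|T|.+1)%N by rewrite ltnS (leq_trans leH) ?max_card.
  rewrite -[leqLHS]/(val (Ordinal ltsT)) /tm leq_bigmax_cond //.
  exact/asboolP.
have F0 : forces_component r G 0.
  move=> c'.
  have e0 e : e \in (finset.set0 : graph T) -> val e \subset [set x]%SET.
    by rewrite inE.
  exists (Subgraph (finset.sub0set G) e0); split=> //.
  - split=> /=; first by apply/set0Pn; exists x; rewrite inE.
    by move=> y z /=; rewrite !inE => /eqP-> /eqP->; apply: connect0.
  - by exists (Ordinal r0) => e /=; rewrite inE.
have [i Fi tmE] : {i : 'I_#|T|.+1 | `[< forces_component r G i >]
    & tm r G = i}.
  by apply: eq_bigmax_cond; apply/card_gt0P; exists ord0; apply/asboolP.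
have /asboolP/(_ c)[H [cH mH leH]] := Fi.
by exists H; split=> //; rewrite (leq_trans le_s) // tmE.
Qed.

Section Gnp.
Variable R : realType.

(* G(n, p) is the case T = 'I_n. *)
Definition Gp_weight (T : finType) (p : R) (G : graph T) : R :=
  \prod_(e : vpair T) (if e \in G then p else 1 - p).

Definition Gp_prob (T : finType) (p : R) (A : set (graph T)) : R :=
  \sum_(G : graph T | G \in A) Gp_weight p G.

Lemma Gp_probT (T : finType) (p : R) : Gp_prob p [set: graph T] = 1.
Proof.
rewrite /Gp_prob (eq_bigl xpredT) => [|G]; last by rewrite in_setT.
rewrite -(bigA_distr _ _ _ (fun=> 1 - p)) big1 // => e _.
by rewrite /= addrCA subrr addr0.
Qed.

Definition aas (p : nat -> R) (A : forall n, set (graph 'I_n)) : Prop :=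
  (fun n => Gp_prob (p n) (A n)) @ \oo --> (1 : R).

End Gnp.

(* Main.v *)
(* The only property of G(n, p) that is used is that any two disjoint sets of at
   least n / q vertices are joined by an edge; for p >= 6 q^2 / n this fails with
   probability at most 2^-n by a union bound over the pairs of sets.

   Given such a graph and a colouring, fix a colour c0.  If no component in c0
   has (1 - 1/E) n vertices, some union X of these components and its complement
   Y both have linear size, and only the r - 1 other colours occur between them.
   Partition the vertices into many small parts, and say that two vertices have
   the same type if they lie on the same side and in the same part and relate in
   the same way to the monochromatic components inside all unions of two parts,
   where small components are merged into bins to keep the number of types
   bounded.  Two common types on different sides are joined by an edge, of some
   colour chi, which puts all their vertices in the same bin of colour chi.  So
   chi is a colouring of an almost complete bipartite graph with r - 1 colours, in which
   a Cauchy-Schwarz argument finds an edge xy such that the chi(x, y)-degrees of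
   x and y add up to almost n / (r - 1).  All these neighbours send an edge of
   that colour to the component of x inside the union of the parts of x and y;
   as that component is small, most of them are leaves of a tree with that
   component as its core. *)

Require Import Defs.
From mathcomp Require Import all_boot all_order all_algebra.
From mathcomp Require Import all_classical all_reals all_analysis.
From mathcomp Require Import zify ring lra.

Set Implicit Arguments.
Unset Strict Implicit.
Unset Printing Implicit Defensive.

Import Order.TTheory GRing.Theory Num.Theory.
Import numFieldNormedType.Exports.

(** * Labelling components with a bounded number of bins *)

(* Ordering the components, put a component in bin [pos / m], where pos is the
   number of vertices in earlier components.  The boolean separates the
   component of size at least m that may end a bin. *)
Lemma component_labels (T : finType) (e : rel T) (M : nat) :
  connect_sym e -> (0 < M)%N ->
  exists f : T -> 'I_M * bool,
  [/\ forall x y, connect e x y -> f x = f y,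
      forall x y, f x = f y -> (f x).2 -> connect e x y &
      forall x, ~~ (f x).2 ->
        (#|[set y | f y == f x]%SET| <= 2 * (#|T| %/ M).+1)%N].
Proof.
move=> sym_e M_gt0; set m := (#|T| %/ M).+1.
pose rk x : nat := enum_rank (fingraph.root e x).
pose comp x := [set y | connect e x y]%SET.
pose before x := [set y | (rk y < rk x)%N]%SET.
have rkE x y : (rk x == rk y) = connect e x y.
  by rewrite /rk -root_connect // (inj_eq val_inj) (inj_eq enum_rank_inj).
have before_lt x : (#|before x| %/ m < M)%N.
  rewrite ltn_divLR // (@leq_trans #|T|) //.
    rewrite -cardsT; apply/proper_card/properP; split; first exact: finset.subsetT.
    by exists x; rewrite !inE ?ltnn.
  by rewrite mulnC; apply/ltnW/ltn_ceil.
have before_add x z : (rk z < rk x)%N -> (#|before z| + #|comp z| <= #|before x|)%N.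
  move=> zx; rewrite -cardsUI.
  have -> : (before z :&: comp z = finset.set0)%SET.
    by apply/setP => y; rewrite !inE -rkE; apply/negbTE; lia.
  rewrite cards0 addn0 subset_leq_card //; apply/fintype.subsetP => y.
  by rewrite !inE -rkE; lia.
exists (fun x => (Ordinal (before_lt x), (m <= #|comp x|)%N)); split.
- move=> x y; rewrite -rkE => /eqP exy.
  have eb : before x = before y by apply/setP => z; rewrite !inE exy.
  have ec : comp x = comp y by apply/setP => z; rewrite !inE -!rkE exy.
  by congr pair; [apply: val_inj; rewrite /= eb | rewrite ec].
(* A component of size at least [m] pushes every later position at least [m] further, out of its
   bin. *)
- move=> x y [eq_bin eq_big] /= big_x; rewrite -rkE.
  have big_y : (m <= #|comp y|)%N by rewrite -eq_big.
  have bx := ltn_ceil #|before x| (ltn0Sn (#|T| %/ M)).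
  have bX := leq_divM #|before x| m.
  have bY := leq_divM #|before y| m.
  have by_ := ltn_ceil #|before y| (ltn0Sn (#|T| %/ M)).
  move: eq_bin bX bY bx by_; rewrite -/m => -> bX bY bx by_.
  by case: (ltngtP (rk x) (rk y)) => // /before_add; lia.
- move=> x /= small_x; set cl := [set y | _]%SET.
  have xcl : x \in cl by rewrite inE.
  pose u := [arg max_(y > x in cl) rk y]; pose z := [arg min_(y < x in cl) rk y].
  have [ucl umax] : u \in cl /\ forall y, y \in cl -> (rk y <= rk u)%N.
    by rewrite /u; case: arg_maxnP.
  have [zcl zmin] : z \in cl /\ forall y, y \in cl -> (rk z <= rk y)%N.
    by rewrite /z; case: arg_minnP.
  have clP y : y \in cl -> (#|before y| %/ m = #|before x| %/ m)%N /\ (#|comp y| < m)%N.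
    by rewrite inE => /eqP[-> big_y]; move: small_x; rewrite -big_y ltnNge.
  (* The class runs from the component of [z] to that of [u]. Their positions share a bin, so differ
     by less than [m], and the component of [u] adds fewer than [m] vertices. *)
  have cl_sub : (cl \subset (before u :\: before z) :|: comp u)%SET.
    apply/fintype.subsetP => y ycl; rewrite !inE -rkE.
    by have := umax _ ycl; have := zmin _ ycl; lia.
  apply: leq_trans (subset_leq_card cl_sub) _.
  apply: leq_trans (leq_card_setU _ _) _.
  have zu : (before z \subset before u)%SET.
    by apply/fintype.subsetP => y; rewrite !inE => yz; apply: leq_trans yz (zmin _ ucl).
  rewrite cardsD (finset.setIidPr zu).
  have [bu cu] := clP _ ucl; have [bz _] := clP _ zcl.
  have := ltn_ceil #|before u| (ltn0Sn (#|T| %/ M)).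
  have := leq_divM #|before z| m.
  by rewrite -/m bu bz; lia.
Qed.

(** * Building trees from parent functions *)

Lemma adj_sym (T : finType) (F : graph T) : symmetric (adj F).
Proof. by move=> x y; apply: eq_existsb => e; rewrite finset.setUC. Qed.

Lemma set2_eq (T : finType) (x y z w : T) :
  [set x; y]%SET = [set z; w]%SET -> (x = z /\ y = w) \/ (x = w /\ y = z).
Proof.
move=> E.
have : x \in [set z; w]%SET by rewrite -E !inE eqxx.
have : y \in [set z; w]%SET by rewrite -E !inE eqxx orbT.
have : z \in [set x; y]%SET by rewrite E !inE eqxx.
have : w \in [set x; y]%SET by rewrite E !inE eqxx orbT.
by rewrite !inE => /orP[]/eqP ? /orP[]/eqP ? /orP[]/eqP ? /orP[]/eqP ?; subst; auto.
Qed.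

(** Following [par] lowers [h] and so ends at [x0], whence connectedness. On a cycle, both
    neighbours of a vertex of maximal height would be its parent. *)
Lemma parent_tree (T : finType) (G F : graph T) (W : {set T}) (x0 : T)
    (par : T -> T) (h : T -> nat) :
  F \subset G -> x0 \in W ->
  (forall y, y \in W -> y != x0 ->
     [/\ par y \in W, (h (par y) < h y)%N & adj F y (par y)]) ->
  exists H : subgraph G,
  [/\ tree_sg H, edges H \subset F, vertices H = W &
      forall y, y \in W -> y != x0 ->
        (forall z, z \in W -> z != x0 -> par z != y) -> deg H y = 1%N].
Proof.
move=> sFG x0W parP.
pose E : graph T := [set e in F | [exists y in W, (y != x0) && (val e == [set y; par y]%SET)]]%SET.
have EP e : e \in E -> exists2 y, y \in W & y != x0 /\ val e = [set y; par y]%SET.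
  rewrite inE => /andP[_ /existsP[y /and3P[yW yx0 /eqP ey]]].
  by exists y.
have sEF : E \subset F by apply/fintype.subsetP => e; rewrite inE => /andP[].
have sEW e : e \in E -> val e \subset W.
  move=> /EP[y yW [yx0 ->]]; have [pW _ _] := parP y yW yx0.
  by apply/fintype.subsetP => z; rewrite !inE => /orP[]/eqP->.
have adjE y : y \in W -> y != x0 -> adj E y (par y).
  move=> yW yx0; have [pW _ /existsP[e /andP[eF eE]]] := parP y yW yx0.
  apply/existsP; exists e; rewrite eE andbT inE eF /=.
  by apply/existsP; exists y; rewrite yW yx0.
have adjEP y z : adj E y z -> (h z < h y)%N -> z = par y.
  case/existsP => e /andP[/EP[w wW [wx0 ->]] /eqP /set2_eq[[<- <-] //|[<- <-]]].
  by have [_ + _] := parP w wW wx0; lia.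
exists (Subgraph (fintype.subset_trans sEF sFG) sEW); split => //=.
- split; first split => /=.
  + by apply/set0Pn; exists x0.
  + have conn y : y \in W -> connect (adj E) x0 y.
      have [k] := ubnP (h y); elim: k y => // k IH y hy yW.
      have [->|yx0] := eqVneq y x0; first exact: connect0.
      have [pW hp _] := parP y yW yx0.
      apply: connect_trans (IH (par y) _ pW) _; first by lia.
      by apply: connect1; rewrite adj_sym adjE.
    move=> x y xW yW; apply: connect_trans (conn y yW).
    by rewrite (sym_connect_sym (@adj_sym _ E)) conn.
  + move=> s s2 /= us.
    have [y0 y0s] : exists y, y \in s.
      by case: s s2 us => // y s _ _; exists y; rewrite inE eqxx.
    pose y := [arg max_(y > y0 in s) h y].
    have [ys ymax] : y \in s /\ forall z, z \in s -> (h z <= h y)%N.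
      by rewrite /y; case: arg_maxnP.
    have [i s' rs] := rot_to ys.
    have : ucycle (adj E) (rot i s) by rewrite /ucycle rot_cycle rot_uniq.
    have s'2 : (1 < size s')%N by move: s2; rewrite -(size_rot i) rs.
    have mem z : z \in s' -> z \in s by move=> zs'; rewrite -(mem_rot i) rs inE zs' orbT.
    (* Here [a] and [b] are the successor and the predecessor of [y] on the cycle, distinct because
       its length exceeds 2. *)
    rewrite rs; case/lastP: s' s'2 mem {rs} => // s' b; case: s' => [|a s'] // _ mem.
    rewrite /ucycle /= !rcons_path last_rcons => /andP[/andP[ya /andP[_ by_]]].
    move=> /and3P[_ ab _].
    have low z : adj E y z -> z \in s -> z = par y.
      move=> yz zs; have := ymax z zs; rewrite leq_eqVlt => /orP[/eqP eh|]; last exact: adjEP.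
      case/existsP: yz => e /andP[/EP[w wW [wx0 ->]] /eqP /set2_eq[[<- <-] //|[ey ez]]].
      by have [_ + _] := parP w wW wx0; rewrite ez ey; lia.
    have ea : a = par y by apply: low => //; apply: mem; rewrite mem_rcons !inE eqxx orbT.
    have eb : b = par y.
      by apply: low; [rewrite adj_sym | apply: mem; rewrite mem_rcons !inE eqxx].
    by move: ab; rewrite ea eb mem_rcons inE eqxx.
- move=> y yW yx0 ynp; rewrite /deg /=.
  have [e0 /andP[e0E /eqP e0y]] := existsP (adjE y yW yx0).
  apply/eqP/cards1P; exists e0; apply/setP => e; rewrite !inE.
  apply/idP/eqP => [/andP[eE ye]|->]; last first.
    by move: e0E; rewrite inE => ->; rewrite e0y !inE eqxx.
  have [|z zW [zx0 ez]] := EP e; first by rewrite inE.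
  apply: val_inj; move: ye; rewrite e0y ez !inE => /orP[/eqP-> //|/eqP yp].
  by have := ynp z zW zx0; rewrite yp eqxx.
Qed.

(** Take for [h] the distance from [x], and for [par z] the last vertex but one of a shortest path
    to [z]. *)
Lemma breadth_first (T : finType) (e : rel T) (x : T) :
  exists par : T -> T, exists h : T -> nat,
    forall z, connect e x z -> z != x ->
      [/\ connect e x (par z), (h (par z) < h z)%N & e (par z) z].
Proof.
pose Q z k := exists2 p, path e x p & last x p = z /\ size p = k.
have [h hP] : {h : T -> nat & forall z, connect e x z ->
    Q z (h z) /\ forall k, Q z k -> (h z <= k)%N}.
  apply: (@boolp.choice _ _ (fun z k => connect e x z -> Q z k /\ forall k', Q z k' -> (k <= k')%N)) => z.
  have [/connectP[p xp ->]|] := boolP (connect e x z); last by exists 0%N.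
  have exQ : exists k, `[< Q (last x p) k >] by exists (size p); apply/asboolP; exists p.
  exists (ex_minn exQ) => _; case: ex_minnP => k /asboolP Qk kmin; split => // k' Qk'.
  by apply: kmin; apply/asboolP.
have [par parP] : {par : T -> T & forall z, connect e x z -> z != x ->
    [/\ connect e x (par z), (h (par z) < h z)%N & e (par z) z]}.
  apply: (@boolp.choice _ _ (fun z w => connect e x z -> z != x ->
    [/\ connect e x w, (h w < h z)%N & e w z])) => z.
  have [xz|] := boolP (connect e x z); last by exists z.
  have [-> |zx] := eqVneq z x; first by exists x.
  have [[p xp [pz ph]] _] := hP z xz; case/lastP: p xp pz ph => [|p w].
    by move=> _ /= xz'; rewrite xz' eqxx in zx.
  rewrite rcons_path last_rcons size_rcons => /andP[xp wz] <- ph.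
  have xlast : connect e x (last x p) by apply/connectP; exists p.
  exists (last x p) => _ _; split=> //; have [_ hmin] := hP _ xlast.
  by rewrite -ph ltnS; apply: hmin; exists p.
by exists par, h.
Qed.

(** A breadth-first tree spans the core, the set reachable from [x]; the vertices of [L] outside the
    core hang on it as leaves, and only those inside are lost. With [L] empty this is just a
    spanning tree of the core. *)
Lemma core_tree (T : finType) (G F : graph T) (e : rel T) (x : T) (L : {set T}) :
  F \subset G -> (forall y z, e y z -> adj F y z) ->
  (forall y, y \in L -> exists2 z, connect e x z & adj F y z) ->
  exists H : subgraph G,
  [/\ tree_sg H, edges H \subset F,
      (#|[set z | connect e x z]%SET| <= order_sg H)%N &
      (#|L| <= num_leaves H + #|[set z | connect e x z]%SET|)%N].
Proof.
move=> sFG eF LP; set core := [set z | connect e x z]%SET.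
have [par [h parP]] := breadth_first e x.
have [nb nbP] : {nb : T -> T & forall y, y \in L -> connect e x (nb y) /\ adj F y (nb y)}.
  apply: (@boolp.choice _ _ (fun y z => y \in L -> connect e x z /\ adj F y z)) => y.
  by have [/LP[z xz yz]|] := boolP (y \in L); [exists z | exists y].
pose par' y := if y \in core then par y else nb y.
(* Pendant vertices are placed above the whole core, so heights still drop towards the parent. *)
pose h' y := if y \in core then h y else (\max_z h z).+1.
have h'le z : z \in core -> (h' z < (\max_z h z).+1)%N.
  by move=> zc; rewrite /h' zc ltnS (leq_bigmax z).
have xc : x \in core by rewrite inE connect0.
have parC y : y \in (core :|: L)%SET -> y != x -> par' y \in core.
  rewrite finset.in_setU /par'; case: ifPn => [|yc /= yL _]; last first.
    by rewrite inE; have [] := nbP y yL.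
  by rewrite !inE => xy _ yx; have [] := parP y xy yx.
have [|y yW yx|H [tH sH vH leafH]] := @parent_tree T G F (core :|: L)%SET x par' h' sFG.
- by rewrite finset.in_setU xc.
- have pc := parC y yW yx; split; first by rewrite finset.in_setU pc.
    rewrite {2}/h'; case: ifPn => yc; last exact: h'le.
    rewrite /h' pc /par' yc; rewrite inE in yc.
    by have [] := parP y yc yx.
  move: yW; rewrite finset.in_setU /par'; case: ifPn => [yc _|yc /= /nbP[] //].
  by rewrite inE in yc; have [_ _ /eF] := parP y yc yx; rewrite adj_sym.
exists H; split => //.
  by rewrite /order_sg vH; apply/subset_leq_card/finset.subsetUl.
rewrite -(cardsID core L) addnC; apply: leq_add; last exact/subset_leq_card/finset.subsetIr.
apply/subset_leq_card/fintype.subsetP => y; rewrite finset.in_setD => /andP[yc yL].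
rewrite inE vH finset.in_setU yL orbT /=; apply/eqP/leafH.
- by rewrite finset.in_setU yL orbT.
- by apply: contraNneq yc => ->.
- by move=> z zW zx; apply: contraNneq yc => <-; exact: parC.
Qed.

(** * Cuts and colour degrees *)

Lemma card_cover_le (T I : finType) (S : {set T}) (F : I -> {set T}) (b : nat) :
  (forall x, x \in S -> exists u, x \in F u) ->
  (forall u, #|F u| <= b)%N -> (#|S| <= #|I| * b)%N.
Proof.
move=> SF Fb; apply: (@leq_trans (\sum_u #|F u|)).
  apply: (@leq_trans #|\bigcup_u F u|%SET).
    apply/subset_leq_card/fintype.subsetP => x /SF[u xu].
    by apply/finset.bigcupP; exists u.
  elim/big_ind2: _ => [|A a B b' leA leB|//]; first by rewrite cards0.
  by apply: leq_trans (leq_card_setU _ _) _; apply: leq_add.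
by rewrite -sum_nat_const; apply: leq_sum.
Qed.

(* A maximal union of components missing at least |T| / 2E vertices works. *)
Lemma large_component_or_cut (T : finType) (e : rel T) (E : nat) :
  connect_sym e -> (0 < E)%N -> (0 < #|T|)%N ->
  (exists x, (E * #|T| <= E * #|[set z | connect e x z]%SET| + #|T|)%N) \/
  (exists X : {set T}, [/\ forall x y, connect e x y -> (x \in X) = (y \in X),
     (#|T| < 2 * E * #|X|)%N & (#|T| <= 2 * E * #|~: X|%SET)%N]).
Proof.
move=> sym_e E_gt0 T_gt0.
have [|none] := pselect (exists x, (E * #|T| <= E * #|[set z | connect e x z]%SET| + #|T|)%N).
  by left.
right; pose closedb (X : {set T}) := [forall x, forall y, connect e x y ==> ((x \in X) == (y \in X))].
pose ok X := closedb X && (#|T| <= 2 * E * #|~: X|%SET)%N.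
have ok0 : ok finset.set0.
  rewrite /ok finset.setC0 cardsT; apply/andP; split; last by nia.
  by apply/forallP => x; apply/forallP => y; rewrite !inE eqxx implybT.
have [X /andP[closedX leX] maxX] := @arg_maxnP _ finset.set0 ok (fun X : {set T} => #|X|) ok0.
have cX x y : connect e x y -> (x \in X) = (y \in X).
  by move=> xy; apply/eqP; move/forallP/(_ x)/forallP/(_ y)/implyP: closedX; apply.
exists X; split => //.
have [x xX] : exists x, x \in (~: X)%SET.
  by apply/card_gt0P; case: posnP => // c0; move: leX; rewrite c0; lia.
rewrite finset.in_setC in xX.
pose C := [set z | connect e x z]%SET.
have clC : closedb (X :|: C)%SET.
  apply/forallP => y; apply/forallP => z; apply/implyP => yz.
  rewrite !finset.in_setU (cX _ _ yz) !inE; apply/eqP; congr orb.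
  by apply/idP/idP => h; apply: connect_trans h _ => //; rewrite sym_e.
(* By maximality of [X], adding [C] spoils the bound on the complement. As [none] keeps [C] below (1
   - 1/E)|T|, the set [X] must exceed |T|/2E. *)
have small : ~~ (#|T| <= 2 * E * #|~: (X :|: C)|%SET)%N.
  apply/negP => le; have := maxX (X :|: C)%SET; rewrite /ok clC le => /(_ isT).
  apply/negP; rewrite -ltnNge; apply/proper_card/properP; split; first exact: finset.subsetUl.
  by exists x; rewrite ?finset.in_setU ?inE ?connect0 ?orbT // (negbTE xX).
have nC : (E * #|C| + #|T| < E * #|T|)%N.
  by rewrite ltnNge; apply/negP => le; apply: none; exists x.
have := leq_card_setU X C; have := cardsC X; have := cardsC (X :|: C)%SET.
move: small nC; rewrite -ltnNge.
move: #|~: (X :|: C)|%SET #|~: X|%SET #|X :|: C|%SET #|X| #|C| #|T| => a b c d f n sm nC ca db cdf.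
have : (E * c <= E * (d + f))%N by rewrite leq_mul2l cdf orbT.
have : (E * (c + a) = E * n)%N by rewrite ca.
by lia.
Qed.

(* Linearised Cauchy--Schwarz: the sum over i of (|D| d_i - b)^2 is nonnegative. *)
Lemma colour_degree_square (V I : finType) (B : {set V}) (D : {set I})
    (good : pred V) (chi : V -> I) (beta : nat) :
  (forall y, y \in B -> good y -> chi y \in D) ->
  (#|[set y in B | ~~ good y]%SET| <= beta)%N ->
  (#|B| ^ 2 <= #|D| * (\sum_(y in B | good y)
     #|[set y' in B | good y' && (chi y' == chi y)]%SET|) + 2 * #|B| * beta)%N.
Proof.
move=> chiD bad; set b := #|B|.
pose d i := #|[set y' in B | good y' && (chi y' == i)]%SET|.
have sumd : (\sum_(i in D) d i + #|[set y in B | ~~ good y]%SET| = b)%N.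
  have -> : (\sum_(i in D) d i = \sum_(y in B | good y) 1)%N.
    rewrite (partition_big chi (mem D)) /=; last by move=> y /andP[]; exact: chiD.
    apply: eq_bigr => i _; rewrite /d -sum1_card; apply: eq_bigl => y.
    by rewrite !inE andbA.
  rewrite /b -!sum1_card [RHS](bigID good) /=.
  by congr addn; apply: eq_bigl => y; rewrite !inE.
have sumd2 : (\sum_(y in B | good y) d (chi y) = \sum_(i in D) d i ^ 2)%N.
  rewrite (partition_big chi (mem D)) /=; last by move=> y /andP[]; exact: chiD.
  apply: eq_bigr => i _; rewrite (eq_bigr (fun=> d i)); last by move=> y /andP[_ /eqP->].
  rewrite big_const iter_addn_0 expnS expn1; congr muln.
  by apply: eq_card => y; rewrite !inE -!topredE /= ?andbA.
rewrite sumd2.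
(* Without colours no vertex of [B] is good, so [#|B| <= beta]. *)
case: (posnP #|D|) => [D0|D_gt0].
  move: sumd; rewrite (finset.cards0_eq D0) !big_set0 add0n => e.
  by move: bad; rewrite e cards0 mul0n add0n -mulnn; nia.
have key : (2 * #|D| * b * (\sum_(i in D) d i) <=
    #|D| ^ 2 * (\sum_(i in D) d i ^ 2) + #|D| * b ^ 2)%N.
  rewrite !big_distrr /= -[(#|D| * b ^ 2)%N]sum_nat_const -big_split /=.
  apply: leq_sum => i _; have := nat_Cauchy (#|D| * d i) b; rewrite expnMn.
  move=> h; have -> : (2 * #|D| * b * d i = 2 * (#|D| * d i * b))%N by lia.
  exact: h.
rewrite -(leq_pmul2l D_gt0).
have : (2 * #|D| * b * b <= 2 * #|D| * b * (\sum_(i in D) d i) + 2 * #|D| * b * beta)%N.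
  by rewrite -mulnDr leq_mul2l; apply/orP; right; lia.
set S := (\sum_(i in D) d i)%N in key *.
set S2 := (\sum_(i in D) d i ^ 2)%N in key *.
by rewrite -!mulnn in key *; nia.
Qed.

(** Averaging over good pairs: [colour_degree_square], applied to every row and every column, bounds
    the sum of |D| times both colour degrees below by |A||B|(|A| + |B| - 4 beta), and there are at
    most |A||B| good pairs. *)
Lemma double_star (U V I : finType) (A : {set U}) (B : {set V}) (D : {set I})
    (good : U -> V -> bool) (chi : U -> V -> I) (beta : nat) :
  (forall x y, x \in A -> y \in B -> good x y -> chi x y \in D) ->
  (forall x, x \in A -> #|[set y in B | ~~ good x y]%SET| <= beta)%N ->
  (forall y, y \in B -> #|[set x in A | ~~ good x y]%SET| <= beta)%N ->
  (0 < #|A|)%N -> (0 < #|B|)%N -> (4 * beta < #|A| + #|B|)%N ->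
  exists x y, [/\ x \in A, y \in B, good x y &
    (#|A| + #|B| <= #|D| * (#|[set y' in B | good x y' && (chi x y' == chi x y)]%SET|
       + #|[set x' in A | good x' y && (chi x' y == chi x y)]%SET|) + 4 * beta)%N].
Proof.
move=> chiD badA badB A_gt0 B_gt0 beta_lt.
pose dx x y := #|[set y' in B | good x y' && (chi x y' == chi x y)]%SET|.
pose dy x y := #|[set x' in A | good x' y && (chi x' y == chi x y)]%SET|.
have [[x [y [xA yB gxy le]]]|none] := pselect (exists x y, [/\ x \in A, y \in B,
   good x y & (#|A| + #|B| <= #|D| * (dx x y + dy x y) + 4 * beta)%N]).
  by exists x, y.
(* Integrality gains the 1 that contradicts the average; [beta_lt] keeps the subtraction from being
   truncated. *)
have small x y : x \in A -> y \in B -> good x y ->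
    (#|D| * dx x y + #|D| * dy x y <= #|A| + #|B| - 4 * beta - 1)%N.
  move=> xA yB gxy; case: (leqP (#|A| + #|B|) (#|D| * (dx x y + dy x y) + 4 * beta)) => [le|].
    by case: none; exists x, y.
  by rewrite mulnDr; lia.
have sumA : (#|A| * #|B| ^ 2 <= \sum_(x in A) \sum_(y in B | good x y) #|D| * dx x y
    + #|A| * (2 * #|B| * beta))%N.
  rewrite -!sum_nat_const -big_split /=; apply: leq_sum => x xA; rewrite -big_distrr.
  by apply: colour_degree_square; [move=> y; exact: chiD | exact: badA].
have sumB : (#|B| * #|A| ^ 2 <= \sum_(x in A) \sum_(y in B | good x y) #|D| * dy x y
    + #|B| * (2 * #|A| * beta))%N.
  rewrite (exchange_big_dep (mem B)) /=; last by move=> ? ? _ /andP[].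
  rewrite -!sum_nat_const -big_split /=; apply: leq_sum => y yB.
  rewrite (eq_bigl (fun x => (x \in A) && good x y)) => [|x]; last by rewrite yB.
  rewrite -big_distrr; apply: (@colour_degree_square _ _ A D (good^~ y) (chi^~ y)).
    by move=> x xA; exact: chiD.
  exact: badB.
have total : (\sum_(x in A) \sum_(y in B | good x y) (#|D| * dx x y + #|D| * dy x y)
    <= #|A| * (#|B| * (#|A| + #|B| - 4 * beta - 1)))%N.
  rewrite -[leqRHS]sum_nat_const; apply: leq_sum => x xA.
  rewrite -[leqRHS]sum_nat_const [leqRHS](bigID (good x)) /=.
  by apply: leq_trans (leq_addr _ _); apply: leq_sum => y /andP[yB]; exact: small.
have split_sum : (\sum_(x in A) \sum_(y in B | good x y) (#|D| * dx x y + #|D| * dy x y) =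
   \sum_(x in A) \sum_(y in B | good x y) #|D| * dx x y +
   \sum_(x in A) \sum_(y in B | good x y) #|D| * dy x y)%N.
  by rewrite -big_split; apply: eq_bigr => x _; rewrite big_split.
have Q1 : exists Q, (#|A| + #|B| = Q.+1 + 4 * beta)%N.
  by exists (#|A| + #|B| - 4 * beta - 1)%N; lia.
case: Q1 => Q Q1; move: total; rewrite split_sum.
have -> : (#|A| + #|B| - 4 * beta - 1 = Q)%N by lia.
move: sumA sumB; move: (\sum_(x in A) _)%N (\sum_(x in A) _)%N => S1 S2 sA sB tot.
have : (#|A| * #|B| ^ 2 + #|B| * #|A| ^ 2 <= #|A| * (#|B| * Q) + #|A| * #|B| * (4 * beta))%N.
  by lia.
have -> : (#|A| * #|B| ^ 2 + #|B| * #|A| ^ 2 = #|A| * #|B| * (#|A| + #|B|))%N by ring.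
by rewrite Q1; have : (0 < #|A| * #|B|)%N by [rewrite muln_gt0 A_gt0]; lia.
Qed.

(** * Joined graphs and trees across a cut *)

Definition joined (T : finType) (q : nat) (G : graph T) : Prop :=
  forall A B : {set T}, [disjoint A & B] ->
    (#|T| <= q * #|A|)%N -> (#|T| <= q * #|B|)%N ->
    exists x y, [/\ x \in A, y \in B & adj G x y].

Definition colour_class (T : finType) (r : nat) (G : graph T) (c : coloring r T)
    (i : 'I_r) : graph T := [set e in G | c e == i]%SET.

Lemma colour_class_sub (T : finType) (r : nat) (G : graph T) (c : coloring r T) i :
  colour_class G c i \subset G.
Proof. by apply/fintype.subsetP => e; rewrite inE => /andP[]. Qed.

Lemma adj_colour (T : finType) (r : nat) (G : graph T) (c : coloring r T) x y :
  adj G x y -> exists i, adj (colour_class G c i) x y.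
Proof.
case/existsP => e /andP[eG exy]; exists (c e); apply/existsP; exists e.
by rewrite inE eG eqxx.
Qed.

Lemma monochromatic_class (T : finType) (r : nat) (G : graph T) (c : coloring r T) i
    (H : subgraph G) : edges H \subset colour_class G c i -> monochromatic c H.
Proof.
by move=> /fintype.subsetP sH; exists i => e /sH; rewrite inE => /andP[_ /eqP].
Qed.

Section CrossingTree.
Variables (T P : finType) (r : nat) (G : graph T) (c : coloring r T) (c0 : 'I_r).
Variables (part : T -> P) (M q s : nat) (X : {set T}).

Let U : finType := (P * P * 'I_r)%type.
Let Lab : finType := ('I_M * bool)%type.
(* The type of x records its side, its part, the component labels of x in every
   graph e (k, l, i) (edges of colour i inside parts k and l), and the labels of
   those components to which x is joined by an edge of colour i.  Their number
   does not depend on T. *)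
Definition vertex_type : finType := (bool * P * {ffun U -> Lab} * {set U * Lab})%type.
Let N := #|vertex_type|.
(** This will bound the bad partners of a vertex: one bin of small components for each part of the
    partner and each colour. *)
Let beta := (#|P| * r * (2 * (#|T| %/ M).+1))%N.
Let Gc := colour_class G c.

Hypothesis M_gt0 : (0 < M)%N.
Hypothesis joinedG : joined q G.
Hypothesis X_closed : forall x y, adj (Gc c0) x y -> (x \in X) = (y \in X).
Hypothesis part_small : forall k, (#|[set x | part x == k]%SET| <= s)%N.
(** Types with fewer than |T|/q vertices cover at most N|T|/q vertices in all, so both sides contain
    vertices of common types. [T_large] serves the bound on [beta] in [double_star]. *)
Hypothesis X_large : (N * #|T| < q * #|X|)%N.
Hypothesis CX_large : (N * #|T| < q * #|~: X|%SET)%N.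
Hypothesis T_large : (q * (4 * beta) + N * #|T| < q * #|T|)%N.

Let e (u : U) : rel T := fun x y => [&& adj (Gc u.2) x y,
  part x \in [:: u.1.1; u.1.2] & part y \in [:: u.1.1; u.1.2]].

Let e_sym u : connect_sym (e u).
Proof. by apply: sym_connect_sym => x y; rewrite /e adj_sym; congr andb; rewrite andbC. Qed.

Lemma crossing_tree : exists i (H : subgraph G),
  [/\ tree_sg H, edges H \subset Gc i &
      (q * #|T| <= q * (r.-1 * (num_leaves H + 2 * s) + 4 * beta) + N * #|T|)%N].
Proof.
(* The centre of the double star is a component of some e (k, l, i), hence has at
   most 2 s vertices.  A pair (x, y) is bad when the edge found between their
   types only lies in a bin of small components. *)
have [f fP] := boolp.choice (fun u => component_labels (e_sym u) M_gt0).
pose tau x : vertex_type := (x \in X, part x, [ffun u => f u x],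
  [set v | [exists z, (f v.1 z == v.2) && adj (Gc v.1.2) x z]]%SET).
pose cls x := [set y | tau y == tau x]%SET.
pose typical := [set x | #|T| <= q * #|cls x|]%SET%N.
have q_gt0 : (0 < q)%N by move: X_large; case: (q).
have atypical : (q * #|~: typical|%SET <= N * #|T|)%N.
  apply: (@leq_trans (q * (N * (#|T| %/ q)))); last first.
    by rewrite mulnCA leq_mul // mulnC leq_divM.
  rewrite leq_mul2l; apply/orP; right.
  apply: (@card_cover_le _ _ _ (fun t => [set x | (x \notin typical) && (tau x == t)]%SET)).
    by move=> x; rewrite finset.in_setC => xt; exists (tau x); rewrite inE xt eqxx.
  move=> t; have [->|/set0Pn[x]] :=
    eqVneq [set x | (x \notin typical) && (tau x == t)]%SET finset.set0.
    by rewrite cards0.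
  rewrite inE => /andP[]; rewrite inE -ltnNge => xs /eqP xt.
  rewrite leq_divRL // mulnC; apply: leq_trans (ltnW xs); rewrite leq_mul2l.
  apply/orP; right; apply/subset_leq_card/fintype.subsetP => y.
  by rewrite !inE xt => /andP[].
pose A := (X :&: typical)%SET; pose B := (~: X :&: typical)%SET.
pose chi_pred (t t' : vertex_type) i := (i != c0) && [exists x, exists y,
  [&& tau x == t, tau y == t' & adj (Gc i) x y]].
(* The default [c0] never occurs between [A] and [B], by [chiP]. *)
pose chi x y := odflt c0 [pick i | chi_pred (tau x) (tau y) i].
have chiP x y : x \in A -> y \in B -> chi x y != c0 /\
    exists x' y', [/\ tau x' = tau x, tau y' = tau y & adj (Gc (chi x y)) x' y'].
  rewrite !finset.in_setI finset.in_setC => /andP[xX xt] /andP[yX yt].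
  rewrite /chi; case: pickP => [i /andP[ic0 /existsP[x' /existsP[y']]]|none].
    move=> /and3P[/eqP tx /eqP ty xy].
    by split => //; exists x', y'.
  (* Types record the side, so the two classes are disjoint and [joinedG] applies; [X_closed]
     excludes colour [c0] for the edge found. *)
  have dis : [disjoint cls x & cls y].
    apply/pred0P => z /=; rewrite !inE; apply/negbTE/negP => /andP[/eqP-> /eqP].
    by case=> xy; move: yX; rewrite -xy xX.
  rewrite inE in xt; rewrite inE in yt.
  have [x' [y' [x'x y'y /(adj_colour c)[i xy]]]] := joinedG dis xt yt.
  move: x'x y'y; rewrite !inE => /eqP tx /eqP ty.
  have := none i; rewrite /chi_pred => /negbT/negP[].
  apply/andP; split; last first.
    by apply/existsP; exists x'; apply/existsP; exists y'; rewrite tx ty !eqxx.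
  apply/eqP => ic0; case: tx => x'X _ _ _; case: ty => y'X _ _ _.
  move: (X_closed (x := x') (y := y')); rewrite -ic0 => /(_ xy).
  by rewrite x'X y'X xX (negbTE yX).
have tauP x x' : tau x = tau x' -> [/\ part x = part x', forall u, f u x = f u x' &
   forall u l, [exists z, (f u z == l) && adj (Gc u.2) x z] ->
     [exists z, (f u z == l) && adj (Gc u.2) x' z]].
  case=> _ -> /ffunP ef /setP ea; split => // [u|u l].
    by have := ef u; rewrite !ffunE.
  by have := ea (u, l); rewrite !inE /= => ->.
pose uu x y : U := (part x, part y, chi x y).
have labE x y : x \in A -> y \in B -> f (uu x y) x = f (uu x y) y.
  move=> xA yB; have [_ [x' [y' [/tauP[px fx _] /tauP[py fy _] xy]]]] := chiP x y xA yB.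
  rewrite -fx -fy; have [fc _ _] := fP (uu x y); apply: fc.
  by apply: connect1; rewrite /e xy px py !inE !eqxx ?orbT.
pose good x y := (f (uu x y) x).2.
(* In use, [g] fills in the part of the fixed vertex [z]; only the partner's part and the colour
   vary. *)
have cover (Z : {set T}) (g : P * 'I_r -> U) z : (forall y, y \in Z ->
     exists v, f (g v) y = f (g v) z /\ ~~ (f (g v) z).2) -> (#|Z| <= beta)%N.
  move=> ZP; have -> : beta = (#|{: P * 'I_r}| * (2 * (#|T| %/ M).+1))%N.
    by rewrite card_prod card_ord.
  apply: (@card_cover_le _ _ _ (fun v => if (f (g v) z).2 then finset.set0
     else [set y | f (g v) y == f (g v) z]%SET)).
    by move=> y /ZP[v [ey ez]]; exists v; rewrite (negbTE ez) inE ey eqxx.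
  move=> v; case: ifPn => [_|ez]; first by rewrite cards0.
  by have [_ _] := fP (g v); apply.
have badA x : x \in A -> (#|[set y in B | ~~ good x y]%SET| <= beta)%N.
  move=> xA; apply: (cover _ (fun v => (part x, v.1, v.2)) x) => y.
  rewrite inE => /andP[yB g]; exists (part y, chi x y); split => //=.
  by have := labE x y xA yB.
have badB y : y \in B -> (#|[set x in A | ~~ good x y]%SET| <= beta)%N.
  move=> yB; apply: (cover _ (fun v => (v.1, part y, v.2)) y) => x.
  rewrite inE => /andP[xA g]; exists (part x, chi x y).
  by have := labE x y xA yB; rewrite /uu /= => <-; split.
have cA : (N * #|T| < q * #|A| + q * #|~: typical|%SET)%N.
  apply: leq_trans X_large _; rewrite -mulnDr leq_mul2l; apply/orP; right.
  rewrite -(cardsID typical X) leq_add2l; apply/subset_leq_card/fintype.subsetP => z.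
  by rewrite !inE => /andP[].
have cB : (N * #|T| < q * #|B| + q * #|~: typical|%SET)%N.
  apply: leq_trans CX_large _; rewrite -mulnDr leq_mul2l; apply/orP; right.
  rewrite -(cardsID typical (~: X)%SET) leq_add2l; apply/subset_leq_card/fintype.subsetP => z.
  by rewrite !inE => /andP[].
have cAB : (#|A| + #|B| + #|~: typical|%SET = #|T|)%N.
  rewrite -(cardsC typical); congr addn.
  by rewrite -(cardsID X typical) /A /B finset.setIC finset.setDE [(~: X :&: _)%SET]finset.setIC.
have [||||||x [y [xA yB gxy le]]] := @double_star _ _ _ A B [set~ c0]%SET good chi beta.
- by move=> x y xA yB _; rewrite !inE; have [] := chiP x y xA yB.
- exact: badA.
- exact: badB.
- by have : (0 < q * #|A|)%N; [lia | rewrite muln_gt0 => /andP[]].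
- by have : (0 < q * #|B|)%N; [lia | rewrite muln_gt0 => /andP[]].
- rewrite -(ltn_pmul2l q_gt0).
  have : (q * #|T| = q * (#|A| + #|B|) + q * #|~: typical|%SET)%N by rewrite -mulnDr cAB.
  by lia.
pose i := chi x y; pose u := uu x y.
pose LB := [set y' in B | good x y' && (chi x y' == i)]%SET.
pose LA := [set x' in A | good x' y && (chi x' y == i)]%SET.
(* As the pair [x], [y] is good, the label of [x] belongs to a single component. *)
have fu z : f u z = f u x -> connect (e u) x z.
  by move=> fz; have [_ h _] := fP u; apply: h; rewrite ?fz.
have [||H [tH sH _ leH]] :=
  @core_tree T G (Gc i) (e u) x (LA :|: LB)%SET (colour_class_sub _ _ _).
- by move=> z w /and3P[].
- move=> z; rewrite finset.in_setU => zL.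
  (* The type of [z] records the labels it touches in colour [i]. Some vertex of that type has a
     neighbour of the type of the opposite centre, and this neighbour carries the label of [x]. *)
  suff : [exists w, (f u w == f u x) && adj (Gc u.2) z w].
    by case/existsP => w /andP[/eqP/fu xw zw]; exists w.
  case/orP: zL; rewrite inE => /and3P[zAB _ /eqP chii].
    have [_ [z' [y' [tz /tauP[_ fy _]]]]] := chiP z y zAB yB.
    rewrite chii => zy; have [_ _ h] := tauP _ _ tz; apply: (h u (f u x)).
    by apply/existsP; exists y'; rewrite fy zy -/u labE ?eqxx.
  have [_ [x' [z' [/tauP[_ fx _] tz]]]] := chiP x z xA zAB.
  rewrite chii => xz; have [_ _ h] := tauP _ _ tz; apply: (h u (f u x)).
  by apply/existsP; exists x'; rewrite fx eqxx adj_sym.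
exists i, H; split => //.
have core_small : (#|[set z | connect (e u) x z]%SET| <= 2 * s)%N.
  apply: (@leq_trans #|[set z | part z == part x] :|: [set z | part z == part y]|%SET).
    apply/subset_leq_card/fintype.subsetP => z; rewrite inE => xz.
    have cl : fingraph.closed (e u) [pred z | part z \in [:: part x; part y]].
      by move=> a b /and3P[_ /= + +]; rewrite !inE => -> ->.
    have := closed_connect cl xz; rewrite !inE eqxx /= => /esym; by [].
  by apply: leq_trans (leq_card_setU _ _) _; rewrite mul2n -addnn leq_add.
have LX z : z \in LA -> z \in X by rewrite /LA /A !finset.in_set => /andP[/andP[]].
have LCX z : z \in LB -> z \notin X by rewrite /LB /B !finset.in_set => /andP[/andP[]].
have dis : (LA :&: LB = finset.set0)%SET.
  apply/setP => z; rewrite finset.in_setI finset.in_set0.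
  by apply/negP => /andP[/LX zX /LCX]; rewrite zX.
have cL : (#|LA :|: LB|%SET = #|LB| + #|LA|)%N.
  by have := cardsUI LA LB; rewrite dis cards0 addn0 => ->; exact: addnC.
have cD : #|[set~ c0]%SET| = r.-1 by rewrite cardsC1 card_ord.
rewrite cL in leH; rewrite cD in le.
have : (r.-1 * (#|LB| + #|LA|) <= r.-1 * (num_leaves H + 2 * s))%N.
  by rewrite leq_mul2l; apply/orP; right; apply: leq_trans leH _; rewrite leq_add2l.
have {}le : (#|A| + #|B| <= r.-1 * (#|LB| + #|LA|) + 4 * beta)%N := le.
move=> le2.
(* The atypical vertices, missing from [A] and [B], account for the term [N * #|T|]. *)
have : (#|T| <= (r.-1 * (num_leaves H + 2 * s) + 4 * beta) + #|~: typical|%SET)%N.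
  by rewrite -[leqLHS]cAB leq_add2r (leq_trans le) // leq_add2r.
rewrite -(leq_pmul2l q_gt0) mulnDr => /leq_trans; apply.
by rewrite leq_add2l.
Qed.
End CrossingTree.

(** * Choice of the constants *)

(** Each of the three losses in [crossing_tree] is at most n/4E, out of n/E allowed: [K] controls
    the core, [M] the bad pairs and [q] the atypical vertices. [N] depends on [K] and [M], and [q]
    on [N], but none of them on [T]. *)
Lemma tree_dichotomy (r E : nat) : (1 < r)%N -> (0 < E)%N ->
  exists q n0, (0 < q)%N /\
  forall (T : finType) (G : graph T) (c : coloring r T),
    joined q G -> (n0 <= #|T|)%N ->
    (exists H : subgraph G, [/\ tree_sg H, monochromatic c H &
       (E * #|T| <= E * order_sg H + #|T|)%N]) \/
    (exists H : subgraph G, [/\ tree_sg H, monochromatic c H &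
       (E * #|T| <= E * (r.-1 * num_leaves H) + #|T|)%N]).
Proof.
move=> r_gt1 E_gt0; pose K := (32 * E * r)%N; pose M := (128 * E * K * r)%N.
pose P : finType := ('I_K * bool)%type.
have [N NE] : exists N, #|vertex_type P r M| = N by eexists.
exists (4 * E * N.+1)%N, M; split; first by rewrite !muln_gt0 E_gt0.
move=> T G c JG M_le.
have r_gt0 : (0 < r)%N by lia.
have K_gt0 : (0 < K)%N by rewrite !muln_gt0 E_gt0.
have M_gt0 : (0 < M)%N by rewrite !muln_gt0 E_gt0 r_gt0.
have T_gt0 : (0 < #|T|)%N := leq_trans M_gt0 M_le.
have K_le : (K <= #|T|)%N.
  by apply: leq_trans M_le; rewrite /M mulnAC leq_pmull // !muln_gt0 E_gt0 r_gt0.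
pose c0 : 'I_r := Ordinal r_gt0; pose Gc := colour_class G c.
have sym_Gc : connect_sym (adj (Gc c0)) by apply: sym_connect_sym; exact: adj_sym.
have [[x large]|[X [clX lX lCX]]] := large_component_or_cut sym_Gc E_gt0 T_gt0.
  left; have [||H [tH sH leH _]] :=
    @core_tree T G (Gc c0) (adj (Gc c0)) x finset.set0 (colour_class_sub _ _ _).
  - by [].
  - by move=> y; rewrite inE.
  exists H; split => //; first exact: monochromatic_class sH.
  by apply: leq_trans large _; rewrite leq_add2r leq_mul2l leH orbT.
right.
(* Components of the empty relation are single vertices, so its bins simply cut the vertex set into
   small parts. *)
have sym0 : connect_sym (fun _ _ : T => false) by apply: sym_connect_sym.
have [part [_ part_big part_small]] := component_labels sym0 K_gt0.
have part_le k : (#|[set x | part x == k]%SET| <= 2 * (#|T| %/ K).+1)%N.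
  have [->|/set0Pn[x]] := eqVneq [set x | part x == k]%SET finset.set0.
    by rewrite cards0.
  rewrite inE => /eqP<-; case: (boolP (part x).2) => [big_x|]; last exact: part_small.
  apply: (@leq_trans 1); last by rewrite muln_gt0.
  rewrite -(cards1 x); apply/subset_leq_card/fintype.subsetP => y; rewrite !inE => /eqP xy.
  have /connectP[[|z p] /= yp] := part_big _ _ (esym xy) big_x; first by move=> ->.
  by [].
set m := (#|T| %/ M).+1; pose beta := (#|P| * r * (2 * m))%N.
have cP : #|P| = (2 * K)%N by rewrite card_prod card_ord card_bool mulnC.
have beta_le : (16 * E * beta <= #|T|)%N.
  have := leq_divM #|T| M; rewrite /beta cP /m /M.
  by move: M_le; rewrite /M; move: (#|T| %/ _)%N => d; nia.
have s_le : (16 * E * r.-1 * (#|T| %/ K).+1 <= #|T|)%N.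
  have le_a : (E * r.-1 <= E * r)%N by rewrite leq_mul2l leq_pred orbT.
  have : (E * r.-1 * (#|T| %/ K).+1 <= E * r * (#|T| %/ K).+1)%N.
    by rewrite leq_mul2r le_a orbT.
  have := leq_divM #|T| K; move: (#|T| %/ K)%N => d; move: K_le; rewrite /K.
  by clear; lia.
have beta_lt : (4 * E * N.+1 * (4 * beta) + N * #|T| < 4 * E * N.+1 * #|T|)%N.
  have : (N.+1 * (16 * E * beta) <= N.+1 * #|T|)%N by rewrite leq_mul2l beta_le.
  have : (N.+1 * #|T| <= E * (N.+1 * #|T|))%N by rewrite leq_pmull.
  by clear -T_gt0; move: beta => b; lia.
have X_large (Y : {set T}) : (#|T| <= 2 * E * #|Y|)%N ->
    (N * #|T| < 4 * E * N.+1 * #|Y|)%N.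
  rewrite -(leq_pmul2l (ltn0Sn N)) => le.
  by move: #|T| #|Y| T_gt0 le => n y; lia.
have [|||||i [H [tH sH leH]]] :=
  @crossing_tree T P r G c c0 part M _ (2 * (#|T| %/ K).+1)%N X M_gt0 JG.
- by move=> x y xy; apply: clX; exact: connect1.
- exact: part_le.
- by rewrite NE; exact/X_large/ltnW.
- by rewrite NE; exact: X_large.
- by rewrite NE; exact: beta_lt.
exists H; split => //; first exact: monochromatic_class sH.
rewrite -/m -/beta NE in leH; clear beta_lt.
move: leH s_le beta_le; move: (num_leaves H) #|T| (#|T| %/ K).+1 beta => l n k b.
move: (r.-1) => a le kle ble.
have {}le : (N.+1 * (4 * E * n) <= N.+1 * (4 * E * (a * (l + 2 * (2 * k)) + 4 * b) + n))%N.
  by lia.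
by rewrite leq_pmul2l // in le; lia.
Qed.

(** * Random graphs are joined *)

Local Open Scope ring_scope.

Definition cut (T : finType) (A B : {set T}) : graph T :=
  [set e | [exists x in A, exists y in B, val e == [set x; y]%SET]]%SET.

Lemma card_cut (T : finType) (A B : {set T}) :
  [disjoint A & B] -> (#|A| * #|B| <= #|cut A B|)%N.
Proof.
move=> dAB.
have neq x y : x \in A -> y \in B -> x != y.
  by move=> xA yB; apply: contraTneq yB => <-; rewrite (disjointFr dAB xA).
rewrite -cardsX -(card_imset _ val_inj).
rewrite -(@card_in_imset _ _ (fun u : T * T => [set u.1; u.2]%SET)); last first.
  move=> [x y] [z w]; rewrite !inE /= => /andP[xA yB] /andP[zA wB].
  by move=> /set2_eq[[-> ->] //|[xw _]]; move: (neq _ _ xA wB); rewrite xw eqxx.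
apply/subset_leq_card/fintype.subsetP => _ /imsetP[[x y] + ->]; rewrite inE /= => /andP[xA yB].
have xy2 : #|[set x; y]%SET| == 2 by rewrite cards2 neq.
apply/imsetP; exists (exist (fun e : {set T} => #|e| == 2%N) _ xy2) => //.
by rewrite inE; apply/existsP; exists x; rewrite xA; apply/existsP; exists y; rewrite yB /=.
Qed.


Section GnpProbability.
Variables (R : realType) (T : finType) (p : R).
Hypothesis p01 : 0 <= p <= 1.

Lemma Gp_weight_ge0 (G : graph T) : 0 <= Gp_weight p G.
Proof.
apply: prodr_ge0 => e _; case/andP: p01 => p0 p1.
by case: ifP => // _; rewrite subr_ge0.
Qed.

Lemma Gp_prob_sub (A B : set (graph T)) : (A `<=` B)%classic -> Gp_prob p A <= Gp_prob p B.
Proof.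
move=> sAB; rewrite /Gp_prob [leRHS](bigID (fun G => G \in A)) /=.
rewrite -[leLHS]addr0 lerD //; last by apply: sumr_ge0 => G _; exact: Gp_weight_ge0.
rewrite le_eqVlt; apply/orP; left; apply/eqP; apply: eq_bigl => G.
by apply/idP/andP => [GA|[] //]; split => //; apply/mem_set/sAB/set_mem.
Qed.

(** Putting 0 for [p] at the pairs in [S] kills the terms of graphs meeting [S]; the sum is then an
    expanded product over all pairs. *)
Lemma Gp_prob_avoid (S : graph T) :
  \sum_(G : graph T | [disjoint G & S]) Gp_weight p G = (1 - p) ^+ #|S|.
Proof.
have -> : (1 - p) ^+ #|S| =
    \prod_(e : vpair T) ((if e \in S then 0 else p) + (1 - p)).
  rewrite (bigID (mem S)) /= [X in _ * X]big1 => [|e /negbTE->]; last by rewrite addrC subrK.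
  by rewrite mulr1 (eq_bigr (fun=> 1 - p)) ?prodr_const // => e ->; rewrite add0r.
rewrite bigA_distr [LHS]big_mkcond /=; apply: eq_bigr => G _.
case: ifPn => [dGS|/pred0Pn[e /andP[/= eG eS]]].
  by apply: eq_bigr => e _; case: ifP => // eG; rewrite (disjointFr dGS eG).
by rewrite (bigD1 e) //= eG eS mul0r.
Qed.

(** Union bound over the 4^n pairs of sets: a graph that is not joined misses [cut A B] for two
    large disjoint sets, and such a cut has at least n^2/q^2 pairs. *)
Lemma Gp_prob_joined (q : nat) :
  1 - 4 ^+ #|T| * (1 - p) ^+ (#|T| ^ 2 %/ q ^ 2) <=
  Gp_prob p [set G : graph T | joined q G]%classic.
Proof.
set J := [set G : graph T | joined q G]%classic.
have := Gp_probT T p; rewrite {1}/Gp_prob (bigID (fun G => G \in J)) /=.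
rewrite (eq_bigl (fun G => G \in J)) => [|G]; last by rewrite in_setT.
rewrite -/(Gp_prob p J) lerBlDr => {1}<-; rewrite lerD2l.
pose big (A : {set T}) := (#|T| <= q * #|A|)%N.
apply: (@le_trans _ _ (\sum_(AB : {set T} * {set T} | [&& [disjoint AB.1 & AB.2], big AB.1 & big AB.2])
   \sum_(G : graph T | [disjoint G & cut AB.1 AB.2]) Gp_weight p G)).
  rewrite (exchange_big_dep xpredT) //= [leRHS](bigID (fun G => G \in J)) /= addrC.
  rewrite -[leLHS]addr0; apply: lerD; last first.
    by apply: sumr_ge0 => G _; apply: sumr_ge0 => AB _; exact: Gp_weight_ge0.
  rewrite (eq_bigl (fun G => G \notin J)) => [|G]; last by rewrite in_setT.
  apply: ler_sum => G GJ.
  have [[A B] ABP] : exists AB : {set T} * {set T},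
     [&& [disjoint AB.1 & AB.2], big AB.1 & big AB.2] && [disjoint G & cut AB.1 AB.2].
    apply: contrapT => none; move: GJ => /negP; apply; apply/mem_set => A B dAB bA bB.
    have [dG|/pred0Pn[e /andP[/= eG]]] := boolP [disjoint G & cut A B].
      by case: none; exists (A, B); rewrite /= dAB dG /big bA bB.
    rewrite inE => /existsP[x /andP[xA /existsP[y /andP[yB ey]]]].
    by exists x, y; split => //; apply/existsP; exists e; rewrite eG.
  rewrite (bigD1 (A, B)) //= lerDl.
  by apply: sumr_ge0 => AB _; exact: Gp_weight_ge0.
case/andP: p01 => p0 p1.
have q01 : 0 <= 1 - p <= 1 by rewrite subr_ge0 p1 lerBlDr lerDl.
set k := (#|T| ^ 2 %/ q ^ 2)%N.
have -> : 4 ^+ #|T| * (1 - p) ^+ k = \sum_(AB : {set T} * {set T}) (1 - p) ^+ k.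
  have cT : #|{set T}| = (2 ^ #|T|)%N.
    by have := card_powerset [set: T]%SET; rewrite finset.powersetT !cardsT.
  by rewrite sumr_const card_prod cT -expnMn -[RHS]mulr_natl natrX.
rewrite [leLHS]big_mkcond; apply: ler_sum => -[A B] _ /=.
case: ifP => [/and3P[dAB bA bB]|_]; last by apply: exprn_ge0; case/andP: q01.
rewrite Gp_prob_avoid; case/andP: q01 => *; apply: ler_wiXn2l => //.
(* For [q = 0], division by zero makes the exponent 0. *)
apply: leq_trans (card_cut dAB); rewrite /k; case: (posnP q) => [->|q_gt0].
  by rewrite divn0.
rewrite -(@mulnK (#|A| * #|B|) (q ^ 2)) ?expn_gt0 ?q_gt0 //; apply: leq_div2r.
by rewrite -!mulnn mulnACA ![(_ * q)%N]mulnC leq_mul.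
Qed.
End GnpProbability.

Local Open Scope classical_set_scope.
Local Open Scope ring_scope.

(** With k = n^2/q^2 rounded down, pk is at least 3n for large n, so failure has probability at most
    4^n e^(-3n) <= 4^n 8^(-n) = 2^(-n). *)
Lemma aas_joined (R : realType) (q : nat) (p : nat -> R)
    (A : forall n, set (graph 'I_n)) :
  (0 < q)%N -> (forall n, 0 <= p n <= 1) ->
  (\forall n \near \oo, (6 * q ^ 2)%N%:R / n%:R <= p n) ->
  (\forall n \near \oo, forall G : graph 'I_n, joined q G -> A n G) ->
  aas p A.
Proof.
move=> q_gt0 p01 p_ge JA; rewrite /aas.
apply: (@squeeze_cvgr _ _ _ _ (fun n => 1 - (2^-1 : R) ^+ n) (fun=> 1)); last exact: cvg_cst.
- near=> n; have /andP[p0 p1] := p01 n; apply/andP; split; last first.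
    by rewrite -(Gp_probT 'I_n (p n)); apply: Gp_prob_sub.
  apply: (@le_trans _ _ (Gp_prob (p n) [set G : graph 'I_n | joined q G]%classic)); last first.
    by apply: Gp_prob_sub => //; rewrite /subset; near: n.
  apply: le_trans (Gp_prob_joined _ (p01 n) q); rewrite card_ord lerD2l lerN2.
  set k := (n ^ 2 %/ q ^ 2)%N.
  have n_gt0 : (0 < n)%N by near: n; exists 1%N.
  have n_ge : (2 * q <= n)%N by near: n; exists (2 * q)%N.
  (* Rounding down costs less than a factor 2 since [2 * q <= n]; hence the constant 6 rather than
     3. *)
  have k_ge : (n ^ 2 <= 2 * q ^ 2 * k)%N.
    have := ltn_ceil (n ^ 2) (_ : 0 < q ^ 2)%N; rewrite expn_gt0 q_gt0 => /(_ isT).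
    have : (4 * q ^ 2 <= n ^ 2)%N by rewrite -!mulnn; nia.
    by rewrite -/k; nia.
  have pk : 3 * n%:R <= p n * k%:R.
    apply: le_trans (_ : (6 * q ^ 2)%N%:R / n%:R * k%:R <= _); last first.
      by rewrite ler_wpM2r //; near: n.
    rewrite mulrAC ler_pdivlMr ?ltr0n // -!natrM ler_nat -mulnA mulnn.
    by nia.
  have e8 : expR (- 3) <= 8^-1 :> R.
    rewrite expRN lef_pV2 ?posrE ?expR_gt0 //.
    rewrite -[X in expR X]mulr1 expRM_natl.
    apply: (@le_trans _ _ (2 ^+ 3)); first by rewrite -natrX ler_nat.
    by apply: lerXn2r; rewrite ?nnegrE ?expR_ge0 //; have := expR_ge1Dx (1 : R).
  have -> : (2^-1 : R) ^+ n = 4 ^+ n * 8^-1 ^+ n.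
    by rewrite -exprMn; congr (_ ^+ _); lra.
  rewrite ler_wpM2l ?exprn_ge0 //.
  apply: (@le_trans _ _ (expR (- p n) ^+ k)).
    by apply: lerXn2r; rewrite ?nnegrE ?subr_ge0 ?expR_ge0 //; apply: expR_ge1Dx.
  apply: (@le_trans _ _ (expR (- 3) ^+ n)).
    rewrite -!expRM_natr ler_expR; lra.
  by apply: lerXn2r; rewrite ?nnegrE ?expR_ge0 // invr_ge0.
- rewrite -[X in _ --> X]subr0; apply: cvgB; first exact: cvg_cst.
  by apply: cvg_expr; rewrite ger0_norm; lra.
Unshelve. all: by end_near.
Qed.

(** * From joined graphs to the asymptotic statements *)

Theorem theorem1p8 (R : realType) (r : nat) (hr : (2 <= r)%N) :
  exists eps0 : R, 0 < eps0 /\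
  forall eps : R, 0 < eps -> eps <= eps0 ->
  exists C : R,
  forall p : nat -> R,
    (forall n, 0 <= p n <= 1) ->
    (\forall n \near \oo, C / n%:R <= p n) ->
    aas p (fun n => [set G : graph 'I_n |
      forall c : coloring r 'I_n,
        (exists H : subgraph G,
           [/\ tree_sg H, monochromatic c H &
               (1 - eps) * n%:R <= (order_sg H)%:R]) \/
        (exists H : subgraph G,
           [/\ tree_sg H, monochromatic c H &
               (1 - eps) * (n%:R / (r%:R - 1)) <= (num_leaves H)%:R])])
    /\
    aas p (fun n => [set G : graph 'I_n |
      (1 - eps) * (n%:R / (r%:R - 1)) <= (tm r G)%:R]).
Proof.
(* This choice keeps [1 - eps] nonnegative. *)
exists 1; split=> // eps eps_gt0 eps_le1.
(* Now 1/E <= eps, so the error n/E in [tree_dichotomy] is at most eps n. *)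
pose E := (Num.truncn eps^-1).+1.
have epsE : 1 <= eps * E%:R.
  by rewrite mulrC -ler_pdivrMr // div1r; apply/ltW/truncnS_gt.
have [q [n0 [q_gt0 dich]]] := @tree_dichotomy r E hr isT.
exists (6 * q ^ 2)%N%:R => p p01 p_ge.
have r1_ge1 : 1 <= r%:R - 1 :> R by rewrite lerBrDr -(natrD _ 1 1) ler_nat.
have r1E : (r.-1)%:R = r%:R - 1 :> R.
  by rewrite -subn1 natrB //; apply: ltnW.
have scaleE (n a : nat) : (E * n <= E * a + n)%N -> (1 - eps) * n%:R <= a%:R :> R.
  rewrite -(ler_nat R) natrD !natrM => le.
  have E_gt0 : 0 < E%:R :> R by rewrite ltr0n.
  have n_ge0 : 0 <= n%:R :> R by [].
  by rewrite -(ler_pM2l E_gt0); nra.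
have trees n (G : graph 'I_n) : (n0 <= n)%N -> joined q G -> forall c : coloring r 'I_n,
    (exists H : subgraph G, [/\ tree_sg H, monochromatic c H &
        (1 - eps) * n%:R <= (order_sg H)%:R]) \/
    (exists H : subgraph G, [/\ tree_sg H, monochromatic c H &
        (1 - eps) * (n%:R / (r%:R - 1)) <= (num_leaves H)%:R]).
  move=> n0n JG c; have := dich _ G c JG; rewrite card_ord => /(_ n0n).
  case=> -[H [tH mH le]]; [left|right]; exists H; split => //; first exact: scaleE.
  rewrite mulrA ler_pdivrMr; last by apply: lt_le_trans r1_ge1.
  by rewrite -r1E [leRHS]mulrC -natrM; apply: scaleE.
split; apply: (aas_joined q_gt0 p01 p_ge); near=> n => G JG /=.
  by apply: trees => //; near: n; exact: nbhs_infty_ge.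
have n_gt0 : (0 < n)%N by near: n; exact: nbhs_infty_gt.
(* A natural number reaches the real bound exactly when it reaches [s]. *)
pose s := `|Num.ceil ((1 - eps) * (n%:R / (r%:R - 1)))|%N.
have sE : s%:R = (Num.ceil ((1 - eps) * (n%:R / (r%:R - 1))))%:~R :> R.
  rewrite natr_absz ger0_norm // ceil_ge0 (@lt_le_trans _ _ 0) // mulr_ge0 ?subr_ge0 //.
  by rewrite divr_ge0 // (le_trans _ r1_ge1).
have s_ge : (1 - eps) * (n%:R / (r%:R - 1)) <= s%:R.
  by rewrite sE; exact: ceil_ge.
apply: le_trans s_ge _; rewrite ler_nat; apply/forces_componentP.
- by apply: ltnW.
- by rewrite card_ord.
move=> c; have s_min (a : nat) : (1 - eps) * (n%:R / (r%:R - 1)) <= a%:R -> (s <= a)%N.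
  by move=> le; rewrite -(ler_nat R) sE (_ : a%:R = (a%:Z)%:~R) // ler_int ceil_le_int.
have n0n : (n0 <= n)%N by near: n; exact: nbhs_infty_ge.
(* Either tree is a large enough component: the first since r - 1 >= 1, the second since leaves are
   vertices. *)
have [[H [[cH _] mH le]]|[H [[cH _] mH le]]] := trees n G n0n JG c;
  exists H; split => //; apply: s_min.
  apply: le_trans le; rewrite ler_wpM2l ?subr_ge0 //.
  by rewrite ler_pdivrMr ?ler_peMr //; apply: lt_le_trans r1_ge1.
apply: le_trans le _; rewrite ler_nat; apply/subset_leq_card/fintype.subsetP => y.
by rewrite inE => /andP[].
Unshelve. all: by end_near.
Qed.
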